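(* In any dimension $d\ge 3$, there exists a constant $C=C(d)>0$ such that for every positive integer $N$, there is a point set $\mathcal{P}_N$ in $[0,1)^d$ with $N$ points, for which $$\left\|D_{\mathcal{P}_N}\,\middle|\,\exp\!\big(L^{\frac{2}{d-1}}\big)\right\|\le C\,(\log N)^{\frac{d-1}{2}}.$$
   Context: Discrepancy function: for a positive integer $N$, a point set $\mathcal{P}_N\subset[0,1)^d$ with $N$ points and $x=(x_1,\ldots,x_d)\in[0,1)^d$, $$D_{\mathcal{P}_N}(x)=\sum_{z\in\mathcal{P}_N}\chi_{[0,x)}(z)-N x_1\cdots x_d,$$ where $[0,x)=[0,x_1)\times\cdots\times[0,x_d)$ and $\chi_A$ is the characteristic function of $A$. Exponential Orlicz spaces: let $\psi:[0,\infty)\to[0,\infty)$ be a convex function with $\psi(x)=0$ if and only if $x=0$. For a measurable real-valued function $f$ on $[0,1)^d$ (with Lebesgue measure as probability measure) put $$\left\|f\,\middle|\,L^\psi\right\|=\inf\Big\{K>0:\ \int_{[0,1)^d}\psi(|f(x)|/K)\,dx\le 1\Big\},\qquad \inf\emptyset=\infty.$$ For $\alpha>0$ let $\psi_\alpha$ be a convex function of this kind which equals $e^{x^\alpha}-1$ for $x$ sufficiently large, depending on $\alpha$ (for $\alpha\ge1$ the function $e^{x^\alpha}-1$ may be used for all $x\ge0$). Then $\exp(L^\alpha)=L^{\psi_\alpha}$, with norm $\|f|\exp(L^\alpha)\|=\|f|L^{\psi_\alpha}\|$.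
   Formalization: The bound is stated for every integer N ≥ 2 rather than every positive integer N: for N = 1 the right-hand side is C(log 1)^{(d-1)/2} = 0, while the discrepancy function of a single point is nonzero almost everywhere, so its norm is positive. *)

(* Defs.v *)
From HB Require Import structures.
From mathcomp Require Import all_boot all_order all_algebra finmap.
From mathcomp Require Import all_classical all_reals all_analysis.

Set Implicit Arguments.
Unset Strict Implicit.
Unset Printing Implicit Defensive.

Import Order.TTheory GRing.Theory Num.Theory.
Import numFieldNormedType.Exports.

Local Open Scope classical_set_scope.
Local Open Scope ring_scope.

Section lebesgue_tuple.
Context (R : realType).

Definition tuple_cons n (p : R * n.-tuple R) : n.+1.-tuple R :=
  [tuple of p.1 :: p.2].

(* Lebesgue measure on the Borel sets of R^n: the n-fold product of the
   one-dimensional one, transported along R * R^n -> R^n.+1. *)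
Fixpoint lebesgue_tuple n : set (n.-tuple R) -> \bar R :=
  match n with
  | 0%N => \d_[tuple]
  | n'.+1 => pushforward (lebesgue_measure \x @lebesgue_tuple n')%E
               (@tuple_cons n')
  end.

Lemma measurable_tuple_cons n : measurable_fun setT (@tuple_cons n).
Proof. exact: measurable_cons. Qed.

Section step.
Variables (n : nat) (m : {sigma_finite_measure set (n.-tuple R) -> \bar R}).

Let mS : set (n.+1.-tuple R) -> \bar R :=
  pushforward (lebesgue_measure \x m)%E (@tuple_cons n).

HB.instance Definition _ := Measure.copy mS
  (measure_function_pushforward__canonical__measure_function_Measure
     (lebesgue_measure \x m)%E (@measurable_tuple_cons n)).

Let mS_sigma_finite : sigma_finite setT mS.
Proof.
have /sigma_finiteP[F [UF ndF mF]] :=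
  sigma_finiteT (@lebesgue_measure R).
have /sigma_finiteP[G [UG ndG mG]] := sigma_finiteT m.
exists (fun k => [set x : n.+1.-tuple R |
    F k (thead x) /\ G k [tuple of behead x]]).
  apply/seteqP; split=> // x _.
  have : [set: R] (thead x) by [].
  rewrite UF => -[i _ Fi].
  have : [set: n.-tuple R] [tuple of behead x] by [].
  rewrite UG => -[j _ Gj].
  exists (maxn i j) => //; split.
    by have /subsetPset := ndF _ _ (leq_maxl i j); exact.
  by have /subsetPset := ndG _ _ (leq_maxr i j); exact.
move=> k; have [mFk Fk] := mF k; have [mGk Gk] := mG k.
split.
  apply: measurableI.
    rewrite -[X in measurable X]setTI.
    exact: (@measurable_tnth _ R n.+1 ord0).
  rewrite -[X in measurable X]setTI.
  exact: (@measurable_behead _ R n).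
rewrite /mS /pushforward.
rewrite (_ : _ @^-1` _ = F k `*` G k); last first.
  apply/seteqP; split=> -[a t] /= [].
    by rewrite theadE (_ : [tuple of _] = t)//; exact: val_inj.
  move=> Fa Gt; split; first by rewrite theadE.
  by rewrite (_ : [tuple of _] = t)//; exact: val_inj.
rewrite product_measure1E//.
by rewrite lte_mul_pinfty// ge0_fin_numE.
Qed.

HB.instance Definition _ := Measure_isSigmaFinite.Build _ _ _ mS
  mS_sigma_finite.

Definition lebesgue_tuple_step :
  {sigma_finite_measure set (n.+1.-tuple R) -> \bar R} := mS.

End step.

Fixpoint lebesgue_tuple_struct n :
    {sigma_finite_measure set (n.-tuple R) -> \bar R} :=
  match n with
  | 0%N => \d_([tuple] : 0.-tuple R)
  | n'.+1 => lebesgue_tuple_step (lebesgue_tuple_struct n')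
  end.

Lemma lebesgue_tuple_structE n :
  lebesgue_tuple_struct n = @lebesgue_tuple n :> (set _ -> _).
Proof. by elim: n => //= n <-. Qed.

Let lebesgue_tuple0 n : @lebesgue_tuple n set0 = 0%E.
Proof. by rewrite -lebesgue_tuple_structE measure0. Qed.

Let lebesgue_tuple_ge0 n A : (0 <= @lebesgue_tuple n A)%E.
Proof. by rewrite -lebesgue_tuple_structE measure_ge0. Qed.

Let lebesgue_tuple_sigma_additive n : semi_sigma_additive (@lebesgue_tuple n).
Proof.
by rewrite -lebesgue_tuple_structE; exact: measure_semi_sigma_additive.
Qed.

HB.instance Definition _ n := isMeasure.Build _ _ _ (@lebesgue_tuple n)
  (@lebesgue_tuple0 n) (@lebesgue_tuple_ge0 n)
  (@lebesgue_tuple_sigma_additive n).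

Let lebesgue_tuple_sigma_finite n : sigma_finite setT (@lebesgue_tuple n).
Proof. by rewrite -lebesgue_tuple_structE; exact: sigma_finiteT. Qed.

HB.instance Definition _ n := Measure_isSigmaFinite.Build _ _ _
  (@lebesgue_tuple n) (@lebesgue_tuple_sigma_finite n).

Lemma lebesgue_tuple_box n (A : 'I_n -> set R) :
  (forall i, measurable (A i)) ->
  lebesgue_tuple [set x : n.-tuple R | forall i, A i (tnth x i)] =
  (\prod_(i < n) lebesgue_measure (A i))%E.
Proof.
elim: n A => [|n IH] A mA.
  rewrite big_ord0 /= diracE mem_set// => -[].
  by [].
rewrite big_ord_recl/= /pushforward.
rewrite (_ : _ @^-1` _ = A ord0 `*`
    [set x : n.-tuple R | forall i, A (lift ord0 i) (tnth x i)]); last first.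
  apply/seteqP; split=> -[a t] /= H.
    split; first exact: (H ord0).
    by move=> i; have := H (lift ord0 i); rewrite tnthS.
  move=> i; have [->|] := eqVneq i ord0; first exact: H.1.
  by case: (unliftP ord0 i) => [j ->|->] // _; rewrite tnthS; exact: H.2.
rewrite product_measure1E; [by congr (_ * _)%E; exact: IH|exact: mA|].
rewrite (_ : [set x | _] = \big[setI/setT]_(i <- index_enum 'I_n)
    ((@tnth n R)^~ i @^-1` A (lift ord0 i))).
  apply: bigsetI_measurable => i _.
  by rewrite -[X in measurable X]setTI; exact: measurable_tnth.
rewrite -bigcap_seq; apply/seteqP; split=> x /= H i => [_|]; first exact: H.
by apply: H => /=; rewrite mem_index_enum.
Qed.

End lebesgue_tuple.

Arguments lebesgue_tuple {R} n.

Definition unit_cube (R : realType) d : set (d.-tuple R) :=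
  [set x | forall i, tnth x i \in `[0, 1[].
Arguments unit_cube : clear implicits.

Definition anchored_box (R : realType) d (x : d.-tuple R) : set (d.-tuple R) :=
  [set y | forall i, tnth y i \in `[0, tnth x i[].

Definition discrepancy (R : realType) d (P : {fset d.-tuple R})
    (x : d.-tuple R) : R :=
  \sum_(z <- P) \1_(anchored_box x) z - #|` P|%:R * \prod_(i < d) tnth x i.

(* Functions [0, +oo[ -> [0, +oo[ are represented by functions on R of which
   only the values on [0, +oo[ matter. *)
Definition orlicz_function (R : realType) (psi : R -> R) : Prop :=
  [/\ forall x, 0 <= x -> 0 <= psi x,
      convex_function (`[0, +oo[%classic : set R) (psi : R -> R^o) &
      forall x, 0 <= x -> (psi x = 0 <-> x = 0)].

Definition exp_orlicz_function (R : realType) (alpha : R) (psi : R -> R)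
    : Prop :=
  orlicz_function psi /\
  \forall x \near +oo, psi x = expR (x `^ alpha) - 1.

(* The ereal_inf of the empty set is +oo. *)
Definition orlicz_norm (R : realType) d (psi : R -> R) (f : d.-tuple R -> R)
    : \bar R :=
  ereal_inf [set K%:E | K in [set K : R | 0 < K /\
    (\int[lebesgue_tuple d]_(x in unit_cube R d) (psi (`|f x| / K))%:E
       <= 1)%E]].

(* Main.v *)
Require Import Defs.
From mathcomp Require Import all_boot all_order all_algebra finmap.
From mathcomp Require Import all_classical all_reals all_analysis.
From mathcomp Require Import measurable_realfun.
From mathcomp Require Import ring lra zify.

Import Order.TTheory GRing.Theory Num.Theory.
Import numFieldNormedType.Exports.

(** The point sets are stretches of N consecutive elements of a Halton sequence
    in the prime bases b_0, ..., b_(n-1), where n = d - 1, completed by the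
    coordinate i / N:
      z_i = (i / N, phi_(b_0) (i + t), ..., phi_(b_(n-1)) (i + t)),  i < N,
    where phi_b is the radical inverse truncated to m digits, 2 ^ m >= N and
    m = O(log N). The starting index t is chosen at random modulo the product
    of the b_j ^ m, and it is enough to control the average over t of
    psi (|D (x)| / K) for every fixed x.

    Fix x. For each j, expand the indicator function of phi_(b_j) (v) < x_j into
    martingale differences with respect to the residues of v modulo b_j ^ s,
    s = 0, ..., m (digit_diff). Multiplying out, the discrepancy becomes a sum,
    over the multi-indices s in {0, ..., m} ^ n, of functions F_s (t). Two facts
    carry the proof.

    - Every F_s is bounded by a constant depending on n only. For s <> 0 this is
      sum_halton_diff_le: the product of the differences is periodic modulo the
      product of the b_j ^ s_j with vanishing sum over a period, and it is
      supported on one residue class modulo the product of the b_j ^ (s_j - 1);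
      so at most b_0 ... b_(n-1) points of an incomplete period matter.

    - In each coordinate separately the F_s are martingale differences in t.
      Adding to t the multiples of b_j ^ (s_j - 1) times the product of the
      b_i ^ m, i <> j, lets the digit number s_j in base b_j run through all
      its values, and preserves the lower digits in base b_j and the m lowest
      ones in the other bases; so it averages F_s to zero and leaves fixed
      every F_s' with s'_j < s_j.

    For martingale differences the squared norms in L^2k add up to a factor
    O(k) (moment_leD), hence n applications, one for each coordinate, give
      average of D (x) ^ 2k over t <= (C k (m + 1)) ^ (n k)
    (halton_moment_le). These are the moments of a chaos of order n, and they
    bound the average of exp ((|D (x)| / K) ^ (2 / n)) by 3 for some K of order
    m ^ (n / 2) (expR_powR_moment_le). Since psi (u) <= A + exp (u ^ (2 / n))
    (exp_orlicz_le) and, by convexity, psi (e u) <= e psi (u) for 0 <= e <= 1,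
    enlarging K by the factor A + 3 makes the average of psi (|D (x)| / K) at
    most 1. Averaging over t commutes with integrating over x
    (exists_integral_le1). *)

Set Implicit Arguments.
Unset Strict Implicit.
Unset Printing Implicit Defensive.

Local Open Scope classical_set_scope.
Local Open Scope ring_scope.

(** * Powers of sums *)

Section power_inequalities.
Variable R : realFieldType.
Implicit Types (t c h x y l u v : R) (k : nat).

Lemma pow1D_sub1_le h k : 0 <= h ->
  (1 + h) ^+ k - 1 <= k%:R * h * (1 + h) ^+ k.
Proof.
move=> h0; elim: k => [|k IH]; first by rewrite !expr0 mul0r mul0r subrr.
have q0 : 0 <= (1 + h) ^+ k by apply: exprn_ge0; lra.
have k0 : 0 <= k%:R :> R by [].
rewrite exprS -natr1; move: IH; set q := (1 + h) ^+ k in q0 * => IH.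
have : 0 <= k%:R * h * q * h by rewrite !mulr_ge0.
have : 0 <= h * q * h by rewrite !mulr_ge0.
nra.
Qed.

Lemma bernoulli_le h k : 0 <= h -> 1 + k%:R * h <= (1 + h) ^+ k.
Proof.
move=> h0; elim: k => [|k IH]; first by rewrite mul0r addr0 expr0.
rewrite exprS -natr1.
have : (1 + h) * (1 + k%:R * h) <= (1 + h) * (1 + h) ^+ k.
  by rewrite ler_wpM2l// addr_ge0.
have : 0 <= k%:R * h * h by rewrite !mulr_ge0.
lra.
Qed.

(** The parameter c does not change along the induction on k, which is why it is
    only bounded below. *)
Lemma pow1D_double_le k (c : R) t : 16 <= c -> 16 * k%:R <= c ->
  (1 + t) ^+ (k.*2) <= k.*2%:R * t + (1 + c * t ^+ 2) ^+ k.
Proof.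
move=> c16; elim: k => [|k IH] kc; first by rewrite !expr0 mul0r add0r.
have kc' : 16 * k%:R <= c by rewrite -natr1 in kc; lra.
have {}IH := IH kc'.
have k0 : 0 <= k%:R :> R by [].
have t20 : 0 <= t ^+ 2 by exact: sqr_ge0.
have h0 : 0 <= c * t ^+ 2 by apply: mulr_ge0 => //; lra.
have qle := pow1D_sub1_le k h0.
have q1 : 1 <= (1 + c * t ^+ 2) ^+ k by rewrite exprn_ege1 // lerDl.
have qlin := bernoulli_le k h0.
have {}IH : (1 + t) ^+ 2 * (1 + t) ^+ k.*2 <=
    (1 + t) ^+ 2 * (k.*2%:R * t + (1 + c * t ^+ 2) ^+ k).
  by rewrite ler_wpM2l// sqr_ge0.
rewrite doubleS -addn2 exprD mulrC (le_trans IH)//.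
rewrite [X in _ <= _ + X]exprS natrD -mul2n natrM.
move: qle q1 qlin {IH}; set q := (1 + c * t ^+ 2) ^+ k => qle q1 qlin.
suff : 2 * t * (q - 1) + t ^+ 2 * q + 4 * (k%:R * t ^+ 2) +
    2 * (k%:R * t ^+ 2 * t) <= c * t ^+ 2 * q by lra.
have t2q : 0 <= t ^+ 2 * q by rewrite mulr_ge0//; lra.
have kt2 : 0 <= k%:R * t ^+ 2 by rewrite mulr_ge0.
have kt2q : k%:R * t ^+ 2 <= k%:R * t ^+ 2 * q by rewrite ler_peMr.
have kt2qc : 16 * (k%:R * t ^+ 2 * q) <= c * (t ^+ 2 * q).
  by have := ler_wpM2r t2q kc'; lra.
have t2qc : 16 * (t ^+ 2 * q) <= c * (t ^+ 2 * q) by rewrite ler_wpM2r.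
have [t0|t0] := leP t 0.
  have : t * (q - 1) <= 0 by apply: mulr_le0_ge0 => //; lra.
  have : k%:R * t ^+ 2 * t <= 0 by rewrite mulr_ge0_le0.
  lra.
(* The cubic term is absorbed by t^2 q, because q >= 1 + k c t^2. *)
have cubic : 2 * (k%:R * t ^+ 2 * t) <= t ^+ 2 * q.
  rewrite (_ : 2 * _ = t ^+ 2 * (2 * (k%:R * t))); last by ring.
  rewrite ler_wpM2l// (le_trans _ qlin)//.
  have := sqr_ge0 (1 - k%:R * t); have : 0 <= k%:R * (c - k%:R) * t ^+ 2.
    by apply: mulr_ge0 => //; apply: mulr_ge0 => //; lra.
  lra.
(* The linear term is compared with c t^2 q / 2 directly when t >= 4 / c, and
   after expanding q - 1 to first order otherwise. *)
have lin : 2 * t * (q - 1) <= c / 2 * (t ^+ 2 * q).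
  have [tc|tc] := leP 4 (c * t).
    have : 0 <= (c * t - 4) * (t * q) by apply: mulr_ge0; [lra|apply: mulr_ge0; lra].
    lra.
  have : 2 * t * (q - 1) <= 2 * t * (k%:R * (c * t ^+ 2) * q).
    by rewrite ler_wpM2l//; lra.
  have : 0 <= (4 - c * t) * (k%:R * t ^+ 2 * q).
    by rewrite mulr_ge0//; lra.
  lra.
lra.
Qed.

(** The linear term in y vanishes on average over the conditional distribution
    of a martingale difference, and the rest is a power of a quadratic form. *)
Lemma powD_double_le k x y : (0 < k)%N ->
  (x + y) ^+ k.*2 <=
    k.*2%:R * x ^+ k.*2.-1 * y + (x ^+ 2 + 16 * k%:R * y ^+ 2) ^+ k.
Proof.
case: k => // k _; have [->|x0] := eqVneq x 0.
  rewrite doubleS /= !expr0n/= mulr0 mul0r !add0r -doubleS -mul2n exprM.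
  have y2 : 0 <= y ^+ 2 by exact: sqr_ge0.
  apply: lerXn2r; rewrite ?nnegrE//; first exact: mulr_ge0.
  rewrite ler_peMl//.
  rewrite -natr1; have : 0 <= k%:R :> R by []. lra.
have h16 : 16 <= 16 * k.+1%:R :> R by rewrite ler_peMr// ler1n.
have := pow1D_double_le (y / x) h16 (lexx _).
have x2k : 0 <= x ^+ k.+1.*2 by rewrite -mul2n exprM exprn_ge0// sqr_ge0.
move/(ler_wpM2l x2k); rewrite -exprMn mulrDr mulr1 mulrCA divff// mulr1.
move=> /le_trans; apply; rewrite mulrDr lerD//.
  rewrite doubleS /= exprS.
  rewrite (_ : x * _ * _ = k.*2.+2%:R * x ^+ k.*2.+1 * y * (x / x)); last by ring.
  by rewrite divff// mulr1.
rewrite -mul2n exprM -exprMn mulrDr mulr1.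
rewrite (_ : x ^+ 2 * _ = 16 * k.+1%:R * y ^+ 2 * (x / x) ^+ 2); last by ring.
by rewrite divff// expr1n mulr1.
Qed.

Lemma convex_expn k (l : R) u v : 0 <= l <= 1 -> 0 <= u -> 0 <= v ->
  (l * u + (1 - l) * v) ^+ k <= l * u ^+ k + (1 - l) * v ^+ k.
Proof.
move=> /andP[l0 l1] u0 v0; elim: k => [|k IH]; first by rewrite !expr0; lra.
rewrite !exprS.
have : (l * u + (1 - l) * v) * (l * u + (1 - l) * v) ^+ k <=
    (l * u + (1 - l) * v) * (l * u ^+ k + (1 - l) * v ^+ k).
  by rewrite ler_wpM2l// addr_ge0// mulr_ge0//; lra.
suff : 0 <= l * (1 - l) * ((u - v) * (u ^+ k - v ^+ k)) by lra.
rewrite mulr_ge0//; first by rewrite mulr_ge0//; lra.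
by have [uv|/ltW vu] := leP u v;
  [rewrite mulr_le0// subr_le0//|rewrite mulr_ge0// subr_ge0//];
  apply: lerXn2r.
Qed.

End power_inequalities.

(** * Moments of sums of martingale differences *)

Lemma sum_periodic (V : nmodType) (H : nat -> V) M u :
  (forall t, H (t + M)%N = H t) ->
  \sum_(t < M) H (t + u)%N = \sum_(t < M) H t.
Proof.
move=> HM; elim: u => [|u IH]; first by under eq_bigr do rewrite addn0.
rewrite -{}IH; case: M HM => [|M] HM; first by rewrite !big_ord0.
rewrite big_ord_recr [RHS]big_ord_recl /= addrC; congr (_ + _).
  by rewrite add0n addnS addnC -addnS HM.
by apply: eq_bigr => i _; rewrite /bump /= addnS addSn.
Qed.

(** The number A bounds the square of the L^2k norm of f for the uniform
    probability on {0, ..., M - 1}: it is the squares that add up for orthogonal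
    increments. *)
Definition moment_le (R : realFieldType) k M (f : nat -> R) (A : R) :=
  \sum_(t < M) f t ^+ k.*2 <= M%:R * A ^+ k.

Section moments.
Variable R : realFieldType.
Implicit Types (f g : nat -> R) (A B : R) (k M b u m : nat).

(** Martingale form of the triangle inequality in L^2k for squared norms: g has
    conditional mean zero along the orbits of the shift by u, on which f is
    constant. *)
Lemma moment_leD k M f g A B u b : (0 < k)%N -> (0 < b)%N -> 0 < A -> 0 < B ->
  (forall t, f (t + M)%N = f t) -> (forall t, g (t + M)%N = g t) ->
  (forall t, f (t + u)%N = f t) ->
  (forall t, \sum_(c < b) g (t + c * u)%N = 0) ->
  moment_le k M f A -> moment_le k M g B ->
  moment_le k M (fun t => f t + g t) (A + 16 * k%:R * B).
Proof.
move=> k0 b0 A0 B0 fM gM fu gu; rewrite /moment_le => fA gB.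
have kR : 0 < k%:R :> R by rewrite ltr0n.
set C := 16 * k%:R * B; have C0 : 0 < C by rewrite !mulr_gt0.
have fcu c t : f (t + c * u)%N = f t.
  by elim: c => [|c IH]; rewrite ?addn0// mulSn addnCA addnC fu.
(* Averaging over the orbits of the shift kills the term linear in g. *)
have cross : \sum_(t < M) f t ^+ k.*2.-1 * g t = 0.
  apply: (mulfI (_ : b%:R != 0)); first by rewrite pnatr_eq0 -lt0n.
  rewrite mulr0 mulr_natl -[in LHS](card_ord b) -sumr_const.
  transitivity (\sum_(c < b) \sum_(t < M)
      f (t + c * u)%N ^+ k.*2.-1 * g (t + c * u)%N).
    apply: eq_bigr => c _; symmetry.
    apply: (@sum_periodic _ (fun t => f t ^+ k.*2.-1 * g t)) => t.
    by rewrite fM gM.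
  rewrite exchange_big big1// => t _.
  under eq_bigr do rewrite fcu.
  by rewrite -mulr_sumr gu mulr0.
have S0 : 0 < A + C by rewrite addr_gt0.
apply: (@le_trans _ _ (\sum_(t < M) (f t ^+ 2 + 16 * k%:R * g t ^+ 2) ^+ k)).
  apply: (@le_trans _ _ (\sum_(t < M) (k.*2%:R * (f t ^+ k.*2.-1 * g t) +
      (f t ^+ 2 + 16 * k%:R * g t ^+ 2) ^+ k))).
    by apply: ler_sum => t _; rewrite mulrA; exact: powD_double_le.
  by rewrite big_split/= -mulr_sumr cross mulr0 add0r.
(* The rest is Minkowski's inequality in L^k for f ^ 2 and g ^ 2, obtained from
   the convexity of the k-th power with weights proportional to A and C. *)
pose l := A / (A + C).
have l0 : 0 <= l by rewrite divr_ge0 ?ltW.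
have l1 : 0 <= 1 - l by rewrite subr_ge0 ler_pdivrMr// mul1r lerDl ltW.
have lC : 1 - l = C / (A + C).
  by rewrite /l -[1](divff (lt0r_neq0 S0)) -mulrBl addrAC subrr add0r.
apply: (@le_trans _ _ (\sum_(t < M) (A + C) ^+ k *
    (l * (f t ^+ k.*2 / A ^+ k) + (1 - l) * (g t ^+ k.*2 / B ^+ k)))).
  apply: ler_sum => t _.
  rewrite (_ : f t ^+ 2 + _ = (A + C) *
      (l * (f t ^+ 2 / A) + (1 - l) * (g t ^+ 2 / B))); last first.
    by rewrite lC /l /C; field; rewrite !gt_eqF.
  rewrite exprMn ler_wpM2l//; first exact/exprn_ge0/ltW.
  apply: le_trans (convex_expn _ _ _ _) _.
  - by rewrite l0/= -subr_ge0.
  - by rewrite divr_ge0 ?sqr_ge0 ?ltW.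
  - by rewrite divr_ge0 ?sqr_ge0 ?ltW.
  - by rewrite !expr_div_n -!exprM mul2n.
rewrite -mulr_sumr big_split/= -!mulr_sumr -!mulr_suml mulrC.
rewrite ler_wpM2r//; first exact/exprn_ge0/ltW.
have := ler_wpM2l l0 fA; have := ler_wpM2l l1 gB => {}gB {}fA.
rewrite (_ : M%:R = l * M%:R + (1 - l) * M%:R); last by ring.
rewrite !mulrA lerD// ler_pdivrMr ?exprn_gt0//; lra.
Qed.

(** Each parameter costs one factor of order m k: orthogonality costs m and the
    exponent of the moment costs k. *)
Lemma moment_le_martingale k M b (u : nat -> nat) m (F : nat -> nat -> R) B :
  (0 < k)%N -> (0 < b)%N -> 0 < B ->
  (forall s t, (s <= m)%N -> F s (t + M)%N = F s t) ->
  (forall s, (s <= m)%N -> moment_le k M (F s) B) ->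
  (forall s r t, (s < r <= m)%N -> F s (t + u r)%N = F s t) ->
  (forall s t, (0 < s <= m)%N -> \sum_(c < b) F s (t + c * u s)%N = 0) ->
  moment_le k M (fun t => \sum_(s < m.+1) F s t) (m.+1%:R * (16 * k%:R) * B).
Proof.
move=> k0 b0 B0 FM FB Fu F0.
have kR : 1 <= k%:R :> R by rewrite ler1n.
have key j : (j <= m)%N -> moment_le k M (fun t => \sum_(s < j.+1) F s t)
    (B + j%:R * (16 * k%:R * B)).
  elim: j => [|j IH] jm.
    rewrite mul0r addr0 /moment_le.
    under eq_bigr do rewrite big_ord1.
    exact: FB.
  rewrite (_ : B + _ = B + j%:R * (16 * k%:R * B) + 16 * k%:R * B); last first.
    by rewrite -natr1; ring.
  rewrite /moment_le; under eq_bigr do rewrite big_ord_recr/=.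
  apply: (@moment_leD _ _ (fun t => \sum_(s < j.+1) F s t) (F j.+1) _ _
    (u j.+1) b) => //.
  - rewrite ltr_pwDl// mulr_ge0//; first by rewrite !mulr_ge0// ltW.
  - move=> t; apply: eq_bigr => s _; apply: FM.
    exact: leq_trans (ltnW (ltn_ord s)) jm.
  - by move=> t; exact: FM.
  - by move=> t; apply: eq_bigr => s _; apply: Fu; rewrite ltn_ord.
  - by move=> t; apply: F0.
  - exact/IH/ltnW.
  - exact: FB.
apply: le_trans (key m (leqnn m)) _; rewrite ler_wpM2l//.
have kB : 0 <= (16 * k%:R - 1) * B by rewrite mulr_ge0//; [lra|exact: ltW].
have mB : 0 <= m%:R * (16 * k%:R * B) by rewrite !mulr_ge0// ltW.
apply: lerXn2r; rewrite ?nnegrE -?(natr1 m); lra.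
Qed.

End moments.

(** A sum over {0, ..., m} ^ n, nested so that the coordinates can be treated
    one at a time. *)
Fixpoint multisum (V : nmodType) n m (F : seq nat -> V) : V :=
  if n is n'.+1 then \sum_(i < m.+1) multisum n' m (fun s => F (val i :: s))
  else F [::].

Definition in_range n m (s : seq nat) := (size s == n) && all (leq^~ m) s.

Lemma in_range_cons n m i s : (i <= m)%N -> in_range n m s ->
  in_range n.+1 m (i :: s).
Proof. by move=> im /andP[/eqP <- sm]; rewrite /in_range /= im sm eqxx. Qed.

Section multisum.
Variable R : comPzRingType.
Implicit Types (F G : seq nat -> R) (n m : nat).

Lemma eq_multisum n m F G : (forall s, in_range n m s -> F s = G s) ->
  multisum n m F = multisum n m G.
Proof.
elim: n F G => [|n IH] F G FG /=; first exact: FG.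
apply: eq_bigr => i _; apply: IH => s sm; apply: FG.
by apply: in_range_cons => //; rewrite -ltnS ltn_ord.
Qed.

Lemma multisum0 n m : multisum n m (fun=> 0) = 0 :> R.
Proof. by elim: n => //= n IH; rewrite big1. Qed.

Lemma multisumD n m F G :
  multisum n m (fun s => F s + G s) = multisum n m F + multisum n m G.
Proof.
elim: n F G => //= n IH F G; rewrite -big_split /=.
by apply: eq_bigr => i _; rewrite IH.
Qed.

Lemma multisum_sum (I : Type) (r : seq I) (P : pred I) n m (F : I -> seq nat -> R) :
  \sum_(i <- r | P i) multisum n m (F i) =
  multisum n m (fun s => \sum_(i <- r | P i) F i s).
Proof.
elim: n F => //= n IH F; rewrite exchange_big /=.
by apply: eq_bigr => i _; rewrite IH.
Qed.

Lemma multisumZ n m (a : R) F :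
  multisum n m (fun s => a * F s) = a * multisum n m F.
Proof.
by elim: n F => //= n IH F; rewrite mulr_sumr; apply: eq_bigr => i _; rewrite IH.
Qed.

Lemma multisum_nseq0 n m (a : R) :
  multisum n m (fun s => if s == nseq n 0%N then a else 0) = a.
Proof.
elim: n => //= n IH; rewrite big_ord_recl big1 => [|i _] /=.
  by rewrite addr0 -[RHS]IH; apply: eq_multisum => s _; rewrite ?eqseq_cons.
by rewrite -[RHS](multisum0 n m); apply: eq_multisum => s _; rewrite ?eqseq_cons.
Qed.

Lemma prod_sum_multisum n m (g : nat -> nat -> R) :
  \prod_(j < n) \sum_(i < m.+1) g j i =
  multisum n m (fun s => \prod_(j < n) g j (nth 0%N s j)).
Proof.
elim: n g => [|n IH] g /=; first by rewrite !big_ord0.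
rewrite big_ord_recl mulr_suml; apply: eq_bigr => i _.
rewrite (IH (fun j => g j.+1)) -multisumZ.
by apply: eq_multisum => s _; rewrite big_ord_recl.
Qed.

End multisum.

(** The one-parameter bound, applied to one parameter after another: summing out
    the other coordinates preserves both properties of the first one. *)
Lemma moment_le_multisum (R : realFieldType) n m k M (b : nat -> nat)
    (u : nat -> nat -> nat) (F : seq nat -> nat -> R) (beta : R) :
  (0 < k)%N -> (forall j, 0 < b j)%N -> 0 < beta ->
  (forall s t, in_range n m s -> F s (t + M)%N = F s t) ->
  (forall s t, in_range n m s -> `|F s t| <= beta) ->
  (forall s j r t, in_range n m s -> (j < n)%N -> (nth 0%N s j < r <= m)%N ->
    F s (t + u j r)%N = F s t) ->
  (forall s j t, in_range n m s -> (j < n)%N -> (0 < nth 0%N s j)%N ->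
    \sum_(c < b j) F s (t + c * u j (nth 0%N s j))%N = 0) ->
  moment_le k M (fun t => multisum n m (fun s => F s t))
    ((m.+1%:R * (16 * k%:R)) ^+ n * beta ^+ 2).
Proof.
move=> k0 + beta0; elim: n b u F => [|n IH] b u F b0 FM Fb Fu F0.
  rewrite expr0 mul1r /moment_le /= -exprM mul2n.
  rewrite -[X in X%:R](card_ord M) mulr_natl -sumr_const.
  apply: ler_sum => t _; rewrite -(@ger0_norm _ (_ ^+ k.*2)); last first.
    by rewrite -mul2n exprM exprn_ge0// sqr_ge0.
  rewrite normrX; apply: lerXn2r; rewrite ?nnegrE ?normr_ge0 ?(ltW beta0)//.
  exact: Fb.
rewrite exprS -mulrA; apply: (@moment_le_martingale _ _ _ (b 0%N) (u 0%N)
  m (fun i t => multisum n m (fun s => F (i :: s) t))) => //.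
- rewrite mulr_gt0 ?exprn_gt0// !mulr_gt0// ?ltr0n//.
- by move=> i t im; apply: eq_multisum => s sm; apply/FM/in_range_cons.
- move=> i im; apply: (IH (b \o S) (u \o S) (fun s => F (i :: s))).
  + by move=> j; exact: b0.
  + by move=> s t sm; apply/FM/in_range_cons.
  + by move=> s t sm; apply/Fb/in_range_cons.
  + by move=> s j r t sm jn jr; apply: Fu => //; exact: in_range_cons.
  + by move=> s j t sm jn jr; apply: (F0 (i :: s) j.+1) => //; exact: in_range_cons.
- move=> i r t /andP[ir rm]; apply: eq_multisum => s sm.
  apply: Fu; rewrite ?ir//; apply: in_range_cons => //.
  exact: leq_trans (ltnW ir) rm.
- move=> i t /andP[i0 im]; rewrite multisum_sum -[RHS](multisum0 R n m).
  apply: eq_multisum => s sm.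
  by apply: (F0 (i :: s) 0%N) => //; exact: in_range_cons.
Qed.

(** * Digit expansions in one base *)

Section digit_expansion.
Variables (R : realType) (b : nat).
Hypothesis b0 : (0 < b)%N.
Implicit Types (a : R) (m s v w : nat).

Fixpoint radical_inverse m v : R :=
  if m is m'.+1 then ((v %% b)%:R + radical_inverse m' (v %/ b)%N) / b%:R else 0.

Definition first_digit a := Num.truncn (a * b%:R).
Definition digit_shift a := a * b%:R - (first_digit a)%:R.

(** The proportion of the residues v modulo b ^ m with
    radical_inverse m v < a. *)
Fixpoint digit_mean m a : R :=
  if m is m'.+1 then
    ((first_digit a)%:R + digit_mean m' (digit_shift a)) / b%:R
  else (0 < a)%R%:R.

(** With E_s the conditional expectation given v modulo b ^ s, this is
    E_s - E_(s-1) of the indicator function of radical_inverse m v < a (E_0 if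
    s = 0); the recursion strips the common first digit of a and of the point. *)
Fixpoint digit_diff m a s v : R :=
  match m, s with
  | _, 0%N => digit_mean m a
  | 0%N, _ => 0
  | m'.+1, 1%N => (v %% b < first_digit a)%N%:R +
      (v %% b == first_digit a)%N%:R * digit_mean m' (digit_shift a) -
      digit_mean m a
  | m'.+1, s'.+1 =>
      (v %% b == first_digit a)%N%:R * digit_diff m' (digit_shift a) s' (v %/ b)%N
  end.

Let bR : 0 < b%:R :> R. Proof. by rewrite ltr0n. Qed.

Lemma first_digit_itv a : 0 <= a ->
  (first_digit a)%:R <= a * b%:R < (first_digit a)%:R + 1.
Proof. by move=> a0; rewrite natr1 truncn_itv// mulr_ge0. Qed.

Lemma first_digit_lt a : 0 <= a < 1 -> (first_digit a < b)%N.
Proof.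
move=> /andP[a0 a1]; have /andP[da _] := first_digit_itv a0.
by rewrite -(ltr_nat R); apply: le_lt_trans da _; rewrite gtr_pMl.
Qed.

Lemma digit_shift_itv a : 0 <= a < 1 -> 0 <= digit_shift a < 1.
Proof.
move=> /andP[a0 a1]; have /andP[] := first_digit_itv a0.
by rewrite /digit_shift; lra.
Qed.

Lemma digit_shiftE a : a = ((first_digit a)%:R + digit_shift a) / b%:R.
Proof. by rewrite /digit_shift addrC subrK mulfK// gt_eqF. Qed.

Lemma radical_inverse_itv m v : 0 <= radical_inverse m v < 1.
Proof.
elim: m v => [|m IH] v /=; first by rewrite lexx ltr01.
have /andP[r0 r1] := IH (v %/ b)%N.
rewrite divr_ge0 ?addr_ge0//= ltr_pdivrMr// mul1r.
have : (v %% b).+1%:R <= b%:R :> R by rewrite ler_nat ltn_mod.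
by rewrite -natr1; lra.
Qed.

(** Comparison of expansions is lexicographic. *)
Lemma radical_inverse_lt m v a :
  0 <= a < 1 -> radical_inverse m.+1 v < a =
  ((v %% b < first_digit a)%N || (v %% b == first_digit a)%N &&
     (radical_inverse m (v %/ b)%N < digit_shift a)).
Proof.
move=> a01 /=; have /andP[r0 r1] := radical_inverse_itv m (v %/ b)%N.
have /andP[f0 f1] := digit_shift_itv a01.
rewrite [in LHS](digit_shiftE a) ltr_pM2r ?invr_gt0//.
have [lt|gt|->] /= := ltngtP; last by rewrite ltrD2l.
  by move: lt; rewrite -(ler_nat R) -natr1; lra.
by apply/negbTE; rewrite -leNgt; move: gt; rewrite -(ler_nat R) -natr1; lra.
Qed.

Lemma digit_mean_itv m a : 0 <= a < 1 -> 0 <= digit_mean m a <= 1.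
Proof.
elim: m a => [|m IH] a a01 /=; first by case: ltP; rewrite ?lexx ?ler01.
have /andP[r0 r1] := IH _ (digit_shift_itv a01).
rewrite divr_ge0 ?addr_ge0//= ler_pdivrMr// mul1r.
have : (first_digit a).+1%:R <= b%:R :> R by rewrite ler_nat first_digit_lt.
by rewrite -natr1; lra.
Qed.

Lemma digit_mean_approx m a : 0 <= a < 1 ->
  `|digit_mean m a - a| <= b%:R ^- m.
Proof.
elim: m a => [|m IH] a a01 /=.
  rewrite expr0 invr1 ler_norml; case: ltP => /=; lra.
rewrite [X in _ - X]digit_shiftE -mulrBl.
rewrite opprD addrACA subrr add0r normrM [X in _ * X]gtr0_norm ?invr_gt0//.
by rewrite exprSr invfM ler_wpM2r ?invr_ge0 ?ler0n// IH// digit_shift_itv.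
Qed.

Lemma digit_diff0 m a v : digit_diff m a 0 v = digit_mean m a.
Proof. by case: m. Qed.

Lemma sum_digit_diff m a v : 0 <= a < 1 ->
  \sum_(s < m.+1) digit_diff m a s v = (radical_inverse m v < a)%R%:R.
Proof.
elim: m a v => [|m IH] a v a01; first by rewrite big_ord1.
rewrite radical_inverse_lt//.
have := IH _ (v %/ b)%N (digit_shift_itv a01).
rewrite !big_ord_recl /= /bump /=.
under eq_bigr do rewrite add1n.
under [X in _ -> _ + (_ + X) = _]eq_bigr do rewrite !add1n.
rewrite digit_diff0 -mulr_sumr => E.
by case: ltngtP => _ /=; rewrite ?mul0r ?mul1r -?E; ring.
Qed.

Lemma digit_diffD m a s v w : (b ^ s %| w)%N ->
  digit_diff m a s (v + w)%N = digit_diff m a s v.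
Proof.
elim: m a s v w => [|m IH] a [|s] v w //= /dvdnP[w' ->{w}].
rewrite expnSr mulnA addnC modnMDl divnMDl// addnC.
by case: s => // s; rewrite IH// dvdn_mull.
Qed.

Lemma sum_residues (V : nmodType) (h : nat -> V) v q : coprime q b ->
  \sum_(c < b) h ((v + c * q) %% b)%N = \sum_(r < b) h r.
Proof.
move=> qb; pose f (c : 'I_b) := Ordinal (ltn_pmod (v + c * q)%N b0).
rewrite [RHS](@reindex_inj _ _ _ _ f)//= => c d /(congr1 val)/= /eqP.
rewrite eqn_modDl; wlog cd : c d / (c <= d)%N => [hw|].
  have [|/ltnW] := leqP c d; first exact: hw.
  by move=> dc; rewrite eq_sym => /(hw _ _ dc).
rewrite eq_sym eqn_mod_dvd ?leq_mul2r ?cd ?orbT//.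
rewrite -mulnBl Gauss_dvdl 1?coprime_sym// => bdc; apply/val_inj/eqP => /=.
rewrite eqn_leq cd -subn_eq0; move: bdc; case: (d - c)%N (leq_subr c d) => // e.
move=> ed /(dvdn_leq (ltn0Sn _)) be.
by have := leq_trans (leq_trans be ed) (ltnW (ltn_ord d)); have := ltn_ord d; lia.
Qed.

(** As q is invertible modulo b, the digit of v moved by the shift takes every
    value exactly once. *)
Lemma digit_diff_mean0 m a s v q : 0 <= a < 1 -> coprime q b -> (0 < s)%N ->
  \sum_(c < b) digit_diff m a s (v + c * (b ^ s.-1 * q))%N = 0.
Proof.
move=> a01 qb; elim: m a a01 s v => [|m IH] a a01 [|s] v // _ /=.
  by rewrite big1.
case: s => [|s] /=.
  rewrite expn0.
  under eq_bigr do rewrite mul1n.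
  have da := first_digit_lt a01.
  rewrite (sum_residues (fun r => (r < first_digit a)%N%:R +
    (r == first_digit a)%N%:R * digit_mean m (digit_shift a) -
    (((first_digit a)%:R + digit_mean m (digit_shift a)) / b%:R)))//.
  rewrite sumrB big_split /= -mulr_suml.
  rewrite sumr_const card_ord -[X in _ - X]mulr_natr divfK ?gt_eqF//.
  rewrite (_ : \sum_(i < b) (i < _)%N%:R = (first_digit a)%:R); last first.
    rewrite -natr_sum; congr (_%:R).
    rewrite -[RHS](minn_idPr (ltnW da)); elim: (b) => [|n IHn].
      by rewrite big_ord0 min0n.
    by rewrite big_ord_recr/= IHn; case: ltnP => /= ?; lia.
  rewrite (bigD1 (Ordinal da)) //= eqxx big1 => [|i]; last first.
    by rewrite -val_eqE /= => /negbTE ->.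
  by rewrite addr0 mul1r subrr.
transitivity (\sum_(c < b) (v %% b == first_digit a)%N%:R *
    digit_diff m (digit_shift a) s.+1 (v %/ b + c * (b ^ s * q))%N).
  apply: eq_bigr => c _.
  rewrite expnS (_ : c * _ = (c * (b ^ s * q)) * b)%N; last by ring.
  by rewrite addnC modnMDl divnMDl// addnC.
by rewrite -mulr_sumr (IH _ (digit_shift_itv a01) s.+1)// mulr0.
Qed.

Lemma digit_diff_le1 m a s v : 0 <= a < 1 -> `|digit_diff m a s v| <= 1.
Proof.
elim: m a s v => [|m IH] a [|s] v a01.
- by rewrite ger0_norm; have /andP[] := digit_mean_itv 0 a01.
- by rewrite /= normr0.
- by rewrite ger0_norm; have /andP[] := digit_mean_itv m.+1 a01.
case: s => [|s].
  have := digit_mean_itv m.+1 a01; have := digit_mean_itv m (digit_shift_itv a01).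
  rewrite /=; set x := digit_mean m _; set z := (_ + x) / _ => x01 z01.
  rewrite ler_norml; case: ltngtP => _ /=; lra.
rewrite /= -/(digit_diff m _ s.+1 _) normrM -[leRHS]mulr1.
by rewrite ler_pM// ?IH ?digit_shift_itv//; case: eqP; rewrite ?normr0 ?normr1.
Qed.

(** Unless v and a agree in their first s - 1 digits, these digits already decide
    the comparison and the difference vanishes. *)
Lemma digit_diff_support m a s v w :
  digit_diff m a s v != 0 -> digit_diff m a s w != 0 ->
  (v = w %[mod b ^ s.-1])%N.
Proof.
elim: m a s v w => [|m IH] a [|[|s]] v w; rewrite ?modn1 ?eqxx//.
rewrite /= -/(digit_diff m _ s.+1 _) -/(digit_diff m _ s.+1 (w %/ b)%N).
rewrite !mulf_eq0 !negb_or !pnatr_eq0 !eqb0 !negbK.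
move=> /andP[/eqP vb dv] /andP[/eqP wb dw].
have /= vw := IH _ s.+1 _ _ dv dw.
apply/eqP; rewrite (divn_eq v b) (divn_eq w b) vb wb eqn_modDr expnSr.
by rewrite -!muln_modl vw.
Qed.

End digit_expansion.

(** * Consecutive points of a Halton sequence *)

Lemma sum_periodic_modn (V : nmodType) (f : nat -> V) p l : (0 < p)%N ->
  (forall t, f (t + p)%N = f t) -> \sum_(i < p) f i = 0 ->
  \sum_(i < l) f i = \sum_(i < l %% p) f i.
Proof.
move=> p0 fp f0; rewrite [in LHS](divn_eq l p).
elim: (l %/ p)%N => [|q IH]; first by rewrite mul0n add0n.
rewrite -{}IH mulSn -addnA; set l' := (_ + _)%N.
rewrite big_split_ord /= f0 add0r; apply: eq_bigr => i _.
by rewrite addnC fp.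
Qed.

Lemma coprime_prodr (I : Type) (r : seq I) (P : pred I) (e : I -> nat) d :
  (forall i, P i -> coprime d (e i)) -> coprime d (\prod_(i <- r | P i) e i)%N.
Proof.
move=> de; apply: (big_ind (coprime d)) => //; first exact: coprimen1.
by move=> x y dx dy; rewrite coprimeMr dx.
Qed.

Lemma prod_dvdn_coprime n (e : nat -> nat) w :
  (forall i j, (i < n)%N -> (j < n)%N -> i != j -> coprime (e i) (e j)) ->
  (forall j, (j < n)%N -> e j %| w)%N -> (\prod_(j < n) e j %| w)%N.
Proof.
elim: n => [|n IH] co ew; first by rewrite big_ord0 dvd1n.
rewrite big_ord_recr/= Gauss_dvd; last first.
  rewrite coprime_sym coprime_prodr// => i _.
  by apply: co; rewrite // ?gtn_eqF// ltnW// ltnS.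
rewrite ew// andbT; apply: IH => [i j ni nj|j nj].
  by apply: co; exact: ltnW.
by apply: ew; exact: ltnW.
Qed.

Lemma normr_prodB_le (R : realDomainType) n (x y : nat -> R) :
  (forall j, 0 <= x j <= 1) -> (forall j, 0 <= y j <= 1) ->
  `|\prod_(j < n) x j - \prod_(j < n) y j| <= \sum_(j < n) `|x j - y j|.
Proof.
move=> x01 y01; elim: n => [|n IH].
  by rewrite !big_ord0 subrr normr0.
rewrite !big_ord_recr /=.
set p := \prod_(i < n) x i in IH *; set q := \prod_(i < n) y i in IH *.
have q01 : `|q| <= 1.
  rewrite normr_prod; apply: prodr_ile1 => j _.
  by have /andP[y0 y1] := y01 j; rewrite normr_ge0 ger0_norm.
have /andP[x0 x1] := x01 n.
rewrite (_ : p * x n - q * y n = (p - q) * x n + q * (x n - y n)); last by ring.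
apply: le_trans (ler_normD _ _) _; rewrite !normrM lerD//.
  by rewrite (ger0_norm x0); apply: le_trans IH; rewrite ler_piMr.
by rewrite ler_piMl.
Qed.

Section halton.
Variables (R : realType) (n m : nat) (b : nat -> nat) (a : nat -> R).
Hypothesis b2 : forall j, (1 < b j)%N.
Hypothesis b_coprime : forall i j, i != j -> coprime (b i) (b j).
Hypothesis a01 : forall j, 0 <= a j < 1.
Implicit Types (s : seq nat) (j v w : nat).

Let b0 j : (0 < b j)%N. Proof. exact: ltnW. Qed.

Definition halton_diff s v : R :=
  \prod_(j < n) digit_diff (b j) m (a j) (nth 0%N s j) v.

Lemma halton_diffD s v w :
  (forall j, (j < n)%N -> b j ^ nth 0%N s j %| w)%N ->
  halton_diff s (v + w)%N = halton_diff s v.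
Proof.
by move=> bw; apply: eq_bigr => j _; rewrite digit_diffD// bw.
Qed.

Lemma halton_diff_le1 s v : `|halton_diff s v| <= 1.
Proof.
rewrite normr_prod; apply: prodr_ile1 => j _.
by rewrite normr_ge0 digit_diff_le1.
Qed.

Lemma halton_diff_support s v w : halton_diff s v != 0 -> halton_diff s w != 0 ->
  (v = w %[mod \prod_(j < n) b j ^ (nth 0%N s j).-1])%N.
Proof.
rewrite /halton_diff !prodf_seq_neq0 => /allP hv /allP hw.
wlog vw : v w hv hw / (v <= w)%N => [H|].
  by have [|/ltnW] := leqP v w => ?; [|symmetry]; exact: H.
apply/esym/eqP; rewrite eqn_mod_dvd//.
apply: (@prod_dvdn_coprime n (fun j => b j ^ (nth 0 s j).-1)%N) => [i j _ _ ij|j jn].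
  by rewrite coprimeXl ?coprimeXr ?b_coprime.
rewrite -eqn_mod_dvd//; apply/eqP/esym.
by apply: (@digit_diff_support R (b j) m (a j));
  [have := hv (Ordinal jn)|have := hw (Ordinal jn)];
  rewrite mem_index_enum => /(_ isT).
Qed.

Lemma sum_halton_diff_orbit s j v u e : (j < n)%N -> (0 < nth 0%N s j)%N ->
  coprime e (b j) -> u = (b j ^ (nth 0%N s j).-1 * e)%N ->
  (forall i, (i < n)%N -> i != j -> b i ^ nth 0%N s i %| u)%N ->
  \sum_(c < b j) halton_diff s (v + c * u)%N = 0.
Proof.
move=> jn sj ej uE bu.
pose o := \prod_(i < n | i != Ordinal jn) digit_diff (b i) m (a i) (nth 0%N s i) v.
transitivity (\sum_(c < b j) o * digit_diff (b j) m (a j) (nth 0%N s j) (v + c * u)%N).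
  apply: eq_bigr => c _; rewrite /halton_diff (bigD1 (Ordinal jn))//= mulrC.
  congr (_ * _); apply: eq_bigr => i ij.
  by rewrite digit_diffD// dvdn_mull// bu.
by rewrite -mulr_sumr uE digit_diff_mean0// mulr0.
Qed.

Let period s := (\prod_(j < n) b j ^ nth 0 s j)%N.

Let dvd_period s j : (j < n)%N -> (b j ^ nth 0%N s j %| period s)%N.
Proof. by move=> jn; rewrite /period (bigD1 (Ordinal jn))//= dvdn_mulr. Qed.

Let others j (e : nat -> nat) := (\prod_(i < n | nat_of_ord i != j) b i ^ e i)%N.

Let coprime_others j e : coprime (others j e) (b j).
Proof.
rewrite coprime_sym coprime_prodr// => i ij.
by rewrite coprimeXr// b_coprime// eq_sym.
Qed.

Let dvd_others i j e : (i < n)%N -> i != j -> (b i ^ e i %| others j e)%N.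
Proof.
by move=> ni ij; rewrite /others (bigD1 (Ordinal ni))//= dvdn_mulr.
Qed.

Lemma sum_halton_diff_period s j : (j < n)%N -> (0 < nth 0%N s j)%N ->
  \sum_(v < period s) halton_diff s v = 0.
Proof.
move=> jn sj; pose u := (b j ^ (nth 0%N s j).-1 * others j (nth 0%N s))%N.
apply: (mulfI (_ : (b j)%:R != 0)); first by rewrite pnatr_eq0 -lt0n.
rewrite mulr0 mulr_natl -[in LHS](card_ord (b j)) -sumr_const.
transitivity (\sum_(c < b j) \sum_(v < period s) halton_diff s (v + c * u)%N).
  apply: eq_bigr => c _; symmetry; apply: sum_periodic => t.
  by apply: halton_diffD => i ni; exact: dvd_period.
rewrite exchange_big big1//= => v _.
apply: (sum_halton_diff_orbit v jn sj (coprime_others j _) erefl) => i ni ij.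
by rewrite dvdn_mull// dvd_others.
Qed.

(** Full periods cancel, and by the Chinese remainder theorem at most one point
    in every \prod_(j < n) b j ^ (s_j).-1 consecutive ones contributes. *)
Lemma sum_halton_diff_le s j t l : (j < n)%N -> (0 < nth 0%N s j)%N ->
  `|\sum_(i < l) halton_diff s (i + t)%N| <= (\prod_(j < n) b j)%:R.
Proof.
move=> jn sj; have p0 : (0 < period s)%N by rewrite prodn_gt0// => i; rewrite expn_gt0 b0.
(* Only the last, incomplete period of length r remains. *)
rewrite (@sum_periodic_modn _ (fun i => halton_diff s (i + t)%N) (period s))//; last 2 first.
- move=> v; rewrite addnAC halton_diffD// => i ni; exact: dvd_period.
- rewrite sum_periodic; first exact: sum_halton_diff_period sj.
  by move=> v; rewrite halton_diffD// => i ni; exact: dvd_period.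
set r := (l %% _)%N; have rp : (r < period s)%N by rewrite ltn_mod.
pose q := (\prod_(j < n) b j ^ (nth 0 s j).-1)%N.
have q0 : (0 < q)%N by rewrite prodn_gt0// => i; rewrite expn_gt0 b0.
set B := (\prod_(j < n) b j)%N.
have pq : (period s <= B * q)%N.
  rewrite -big_split /=; apply: leq_prod => i _.
  by rewrite -expnS leq_pexp2l// leqSpred.
have B0 : (0 < B)%N by rewrite prodn_gt0.
pose A := [set i : 'I_r | halton_diff s (i + t)%N != 0]%SET.
have fB (i : 'I_r) : (i %/ q < B)%N.
  by rewrite ltn_divLR// (leq_trans _ pq)// (ltn_trans (ltn_ord i)).
have AB : (#|A| <= B)%N.
  rewrite -[leqRHS]card_ord.
  rewrite -(@card_in_imset _ _ (fun i : 'I_r => Ordinal (fB i)) A).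
    exact: max_card.
  move=> i k; rewrite !inE => hi hk [ik]; apply/val_inj => /=.
  have /eqP := halton_diff_support hi hk.
  rewrite eqn_modDr -/q => /eqP ikq.
  by rewrite (divn_eq i q) (divn_eq k q) ik ikq.
apply: le_trans (ler_norm_sum _ _ _) _.
apply: (@le_trans _ _ (#|A|%:R)); last by rewrite ler_nat.
rewrite -sum1_card natr_sum [leRHS]big_mkcond /=; apply: ler_sum => i _.
rewrite inE; case: eqP => [->|_]; first by rewrite normr0.
exact: halton_diff_le1.
Qed.

Lemma prod_radical_inverse_lt v :
  \prod_(j < n) (radical_inverse R (b j) m v < a j)%R%:R =
  multisum n m (fun s => halton_diff s v).
Proof.
rewrite -(prod_sum_multisum _ _ (fun j r => digit_diff (b j) m (a j) r v)).
by apply: eq_bigr => j _; rewrite sum_digit_diff.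
Qed.

(** The terms with s <> 0 are bounded and cancel under shifts of t; the term with
    s = 0 does not depend on t and, since N <= 2 ^ m, it compensates the volume
    up to a constant. *)
Lemma halton_moment_le k N l (y : R) : (0 < k)%N -> (0 < N <= 2 ^ m)%N ->
  0 <= y <= 1 -> N%:R * y <= l%:R <= N%:R * y + 1 ->
  moment_le k (\prod_(j < n) b j ^ m)
    (fun t => \sum_(i < l) \prod_(j < n)
        (radical_inverse R (b j) m (i + t) < a j)%R%:R -
      N%:R * y * \prod_(j < n) a j)
    ((m.+1%:R * (16 * k%:R)) ^+ n * ((\prod_(j < n) b j) + n.+1)%:R ^+ 2).
Proof.
move=> k0 /andP[N0 Nm] /andP[y0 y1] /andP[yl ly].
pose main := N%:R * y * \prod_(j < n) a j.
pose F s t := \sum_(i < l) halton_diff s (i + t)%N -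
  if s == nseq n 0%N then main else 0.
(* A shift of t by u j r moves the digit number r in base b j, and preserves the
   lower digits in base b j and the m lowest ones in all the other bases. *)
pose u j r := (b j ^ r.-1 * others j (fun=> m))%N.
have dvd_m s j : in_range n m s -> (b j ^ nth 0%N s j %| b j ^ m)%N.
  move=> /andP[/eqP sn sm]; apply: dvdn_exp2l.
  have [js|sj] := ltnP j (size s); last by rewrite nth_default.
  exact: (allP sm _ (mem_nth _ js)).
rewrite (_ : (fun t => _) = (fun t => multisum n m (fun s => F s t))); last first.
  apply/funext => t; rewrite /F multisumD -multisum_sum.
  under eq_bigr do rewrite prod_radical_inverse_lt.
  congr (_ + _); rewrite -/main -[main in LHS](multisum_nseq0 n m).
  rewrite -mulN1r -multisumZ; apply: eq_multisum => s _.
  by rewrite mulN1r.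
have FD s t w : (forall j, (j < n)%N -> b j ^ nth 0%N s j %| w)%N ->
    F s (t + w)%N = F s t.
  move=> sw; congr (_ - _); apply: eq_bigr => i _.
  by rewrite addnA halton_diffD.
apply: (@moment_le_multisum R n m k _ b u) => //.
- move=> s t sm; apply: FD => j jn; apply: dvdn_trans (dvd_m s j sm) _.
  by rewrite (bigD1 (Ordinal jn))//= dvdn_mulr.
- move=> s t sm; rewrite /F; case: eqP => [->|snz].
    rewrite (_ : halton_diff _ = fun=> \prod_(j < n) digit_mean (b j) m (a j)); last first.
      apply/funext => v; apply: eq_bigr => j _.
      by rewrite nth_nseq if_same digit_diff0.
    rewrite sumr_const card_ord -[X in X - _]mulr_natl.
    rewrite /main; set p := \prod_(j < n) _; set q := \prod_(j < n) a j.
    have p01 : 0 <= p <= 1.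
      apply/andP; split.
        by apply: prodr_ge0 => j _; have /andP[] := digit_mean_itv (b0 j) m (a01 j).
      by apply: prodr_ile1 => j _; exact: digit_mean_itv.
    have pq : `|p - q| <= n%:R / N%:R.
      apply: le_trans (@normr_prodB_le _ n (fun j => digit_mean (b j) m (a j)) a _ _) _.
      - by move=> j; exact: digit_mean_itv.
      - by move=> j; have /andP[-> /ltW ->] := a01 j.
      rewrite mulr_natl -[X in _ *+ X](card_ord n) -sumr_const.
      apply: ler_sum => j _; apply: le_trans (digit_mean_approx (b0 j) m (a01 j)) _.
      rewrite lef_pV2 ?posrE ?exprn_gt0 ?ltr0n// -natrX ler_nat.
      by apply: leq_trans Nm _; case: (m) => [|m']; rewrite ?expn0 ?leq_exp2r.
    have NR : 0 < N%:R :> R by rewrite ltr0n.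
    have pq' : `|N%:R * y * (p - q)| <= n%:R.
      rewrite normrM normrM (gtr0_norm NR) (ger0_norm y0) -mulrA.
      rewrite ler_pdivlMr// mulrC in pq.
      by apply: le_trans pq; rewrite ler_wpM2l// ler_piMl.
    have /andP[p0 p1] := p01.
    have lp : `|(l%:R - N%:R * y) * p| <= 1.
      rewrite ger0_norm ?mulr_ge0 ?subr_ge0//.
      by rewrite mulr_ile1 ?subr_ge0// lerBlDl.
    rewrite (_ : _ - _ = (l%:R - N%:R * y) * p + N%:R * y * (p - q)); last first.
      by ring.
    apply: le_trans (ler_normD _ _) _.
    rewrite natrD -natr1 -[leLHS]add0r lerD// [leRHS]addrC lerD//.
  rewrite subr0; have [j jn sj] : exists2 j, (j < n)%N & (0 < nth 0%N s j)%N.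
    have /andP[/eqP sn _] := sm.
    have [/all_pred1P|/allPn[x xs x0]] := boolP (all (pred1 0%N) s).
      by rewrite sn => /snz.
    by exists (index x s); rewrite -?sn ?index_mem// nth_index// lt0n.
  apply: le_trans (sum_halton_diff_le _ _ jn sj) _.
  by rewrite ler_nat leq_addr.
- move=> s j r t sm jn /andP[sr rm]; apply: FD => i ni.
  have [->|ij] := eqVneq i j.
    by rewrite dvdn_mulr// dvdn_exp2l// -ltnS (ltn_predK sr).
  by rewrite dvdn_mull// (dvdn_trans (dvd_m s i sm))// (@dvd_others i j (fun=> m)).
- move=> s j t sm jn sj; rewrite /F.
  rewrite ifN; last first.
    by apply: contraTneq sj => ->; rewrite nth_nseq if_same.
  under eq_bigr do rewrite subr0.
  rewrite exchange_big big1//= => i _.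
  under eq_bigr do rewrite addnA.
  apply: (sum_halton_diff_orbit _ jn sj (coprime_others j _) erefl) => i' ni ij.
  by rewrite dvdn_mull// (dvdn_trans (dvd_m s i' sm))// (@dvd_others i' j (fun=> m)).
Qed.

End halton.

(** * Exponential moments and Orlicz functions *)

Section exponential_moment.
Variable R : realType.
Implicit Types (W : nat -> R) (n k M : nat).

Lemma sum_expR_le W M (c : R) :
  (forall K, \sum_(k < K) \sum_(t < M) W t ^+ k / k`!%:R <= c) ->
  \sum_(t < M) expR (W t) <= c.
Proof.
move=> Wc; have cvgW : (fun K => \sum_(t < M) series (exp_coeff (W t)) K) @ \oo
    --> \sum_(t < M) expR (W t).
  elim: (M) => [|M' IH].
    rewrite big_ord0; under eq_fun do rewrite big_ord0.
    exact: cvg_cst.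
  rewrite big_ord_recr/=.
  under eq_fun do rewrite big_ord_recr/=.
  by apply: cvgD IH _; exact: is_cvg_series_exp_coeff.
rewrite -(cvg_lim _ cvgW)//; apply: limr_le; first by apply/cvg_ex; eexists; exact: cvgW.
near=> K; apply: le_trans (Wc K).
by rewrite [leRHS]exchange_big /=; apply: ler_sum => t _; rewrite /series/= big_mkord.
Unshelve. all: by end_near. Qed.

Lemma fact_ge_pow k : (k%:R : R) ^+ k <= expR 1 ^+ k * k`!%:R.
Proof.
case: k => [|k]; first by rewrite !expr0 mul1r fact0.
have := @expR_ge1Dxn R k.+1%:R k (ler0n _ _).
rewrite -expRM_natr mul1r => h.
rewrite -ler_pdivrMr ?ltr0n ?fact_gt0//; apply: le_trans h.
by rewrite lerDr.
Qed.

(** Moments of orders divisible by n suffice: for every th > 0 and x >= 0,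
    x ^ k <= th ^ k + x ^ (n * k) / th ^ ((n - 1) * k), and th of the size of
    the moments makes both terms comparable. *)
Lemma expR_moment_le W n M : (0 < n)%N ->
  (forall t, 0 <= W t) ->
  (forall k, (0 < k)%N -> \sum_(t < M) W t ^+ (n * k) <=
     M%:R * (k%:R / (2 * expR 1)) ^+ (n * k)) ->
  \sum_(t < M) expR (W t) <= 3 * M%:R.
Proof.
move=> n0 W0 Wm; apply: sum_expR_le => K.
have e0 : 0 < expR 1 :> R by exact: expR_gt0.
have term k : (0 < k)%N ->
    \sum_(t < M) W t ^+ k / k`!%:R <= M%:R * (2 * (1 / 2) ^+ k).
  move=> k0; set th : R := k%:R / (2 * expR 1).
  have th0 : 0 < th by rewrite divr_gt0 ?ltr0n// mulr_gt0.
  have WE t : W t ^+ k <= th ^+ k + W t ^+ (n * k) / th ^+ (n.-1 * k).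
    have [le|/ltW ge] := leP (W t) th.
      rewrite ler_wpDr ?divr_ge0 ?exprn_ge0 ?(ltW th0)//.
      by rewrite lerXn2r ?nnegrE ?(ltW th0).
    rewrite ler_wpDl ?exprn_ge0 ?(ltW th0)//.
    rewrite ler_pdivlMr ?exprn_gt0// -[in leRHS](prednK n0) mulSn exprD.
    rewrite ler_wpM2l ?exprn_ge0//.
    by rewrite lerXn2r ?nnegrE ?(ltW th0).
  rewrite -mulr_suml ler_pdivrMr ?ltr0n ?fact_gt0//.
  apply: (@le_trans _ _ (M%:R * (2 * th ^+ k))).
    apply: (@le_trans _ _ (\sum_(t < M)
        (th ^+ k + W t ^+ (n * k) / th ^+ (n.-1 * k)))).
      by apply: ler_sum => t _; exact: WE.
    rewrite big_split /= sumr_const card_ord -mulr_suml -[X in X + _]mulr_natl.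
    rewrite [2 * _]mulr_natl mulr2n mulrDr lerD2l.
    rewrite ler_pdivrMr ?exprn_gt0//; apply: le_trans (Wm k k0) _.
    by rewrite -/th -mulrA -exprD -mulSn prednK.
  rewrite -!mulrA ler_wpM2l// ler_wpM2l//.
  rewrite /th !expr_div_n exprMn expr1n div1r invfM mulrCA ler_wpM2l//.
  by rewrite ler_pdivrMr ?exprn_gt0// mulrC; exact: fact_ge_pow.
case: K => [|K]; first by rewrite big_ord0 mulr_ge0.
suff: \sum_(k < K.+1) \sum_(t < M) W t ^+ k / k`!%:R <=
    M%:R * (3 - 2 * (1 / 2) ^+ K).
  move=> /le_trans; apply; rewrite mulrC ler_wpM2r// lerBlDr lerDl.
  by rewrite mulr_ge0// exprn_ge0// divr_ge0.
elim: K => [|K IH].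
  rewrite big_ord1 expr0.
  under eq_bigr do rewrite expr0 fact0 divr1.
  rewrite sumr_const card_ord -[leLHS]mulr1 -mulr_natl; lra.
rewrite big_ord_recr/=; apply: le_trans (lerD IH (term K.+1 isT)) _.
rewrite -mulrDr ler_wpM2l// exprS; lra.
Qed.

End exponential_moment.

Section orlicz_function.
Variables (R : realType) (psi : R -> R).
Hypothesis psi_orlicz : orlicz_function psi.
Implicit Types (x y e : R).

Lemma orlicz_ge0 x : 0 <= x -> 0 <= psi x.
Proof. by case: psi_orlicz => + _ _; exact. Qed.

Lemma orliczZ e x : 0 <= e <= 1 -> 0 <= x -> psi (e * x) <= e * psi x.
Proof.
move=> e01 x0; case: psi_orlicz => _ convex /(_ 0 (lexx _))[_ /(_ erefl) psi0].
have e01' : Itv.spec (@Itv.num_sem R) (Itv.Real `[0%Z, 1%Z]) e.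
  by rewrite /= /Itv.num_sem /= in_itv /= e01 num_real.
have := convex (Itv.mk e01') x 0.
rewrite !inE /= !in_itv /= !andbT lexx x0 => /(_ isT isT).
move=> h.
have {h} : psi (e * x + (1 - e) * 0) <= e * psi x + (1 - e) * psi 0 by exact: h.
by rewrite psi0 !mulr0 !addr0.
Qed.

Lemma orlicz_homo x y : 0 <= x -> x <= y -> psi x <= psi y.
Proof.
move=> x0 xy; have [y0|y0] := eqVneq y 0.
  by rewrite (_ : x = y)//; apply/eqP; rewrite eq_le xy y0.
have yp : 0 < y by rewrite lt_neqAle eq_sym y0 (le_trans x0).
have h : 0 <= x / y <= 1 by rewrite divr_ge0 ?(ltW yp)// ler_pdivrMr// mul1r.
rewrite -[in leLHS](divfK y0 x); apply: le_trans (orliczZ h (ltW yp)) _.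
by rewrite ler_piMl ?orlicz_ge0 ?(ltW yp)//; case/andP: h.
Qed.

End orlicz_function.

Lemma exp_orlicz_le (R : realType) (alpha : R) psi :
  exp_orlicz_function alpha psi ->
  exists2 A, 0 <= A & forall x, 0 <= x -> psi x <= A + expR (x `^ alpha).
Proof.
move=> [psio [T [Treal psiE]]].
have T0 : 0 <= Num.max 0 T by rewrite le_max lexx.
exists (psi (Num.max 0 T)) => [|x x0]; first exact: orlicz_ge0.
have [xT|Tx] := leP x (Num.max 0 T).
  by rewrite ler_wpDr ?expR_ge0//; exact: orlicz_homo.
rewrite psiE; last by move: Tx; rewrite gt_max => /andP[].
by have := orlicz_ge0 psio T0; lra.
Qed.

(** * Point sets, measurability and averaging *)

Definition prime_seq j := iter j (fun p => s2val (prime_above p)) 2%N.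

Lemma prime_seqP j : prime (prime_seq j).
Proof. by case: j => //= j; case: prime_above. Qed.

Lemma prime_seq_lt i j : (i < j)%N -> (prime_seq i < prime_seq j)%N.
Proof.
have step k : (prime_seq k < prime_seq k.+1)%N by rewrite /=; case: prime_above.
elim: j => // j IH; rewrite ltnS leq_eqVlt => /predU1P[->//|/IH].
by move=> /ltn_trans; apply.
Qed.

Lemma prime_seq_coprime i j : i != j -> coprime (prime_seq i) (prime_seq j).
Proof.
move=> ij; rewrite prime_coprime ?prime_seqP// dvdn_prime2 ?prime_seqP//.
by move: ij; rewrite !neq_ltn => /orP[/prime_seq_lt|/prime_seq_lt] ->; rewrite ?orbT.
Qed.

Section halton_set.
Variables (R : realType) (n m : nat) (b : nat -> nat).
Hypothesis b2 : forall j, (1 < b j)%N.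
Implicit Types (N t i : nat) (x : n.+1.-tuple R).

Definition halton_point N t i : n.+1.-tuple R :=
  [tuple of i%:R / N%:R ::
     [tuple radical_inverse R (b j) m (i + t)%N | j < n]].

Definition halton_set N t : {fset n.+1.-tuple R} :=
  seq_fset tt [seq halton_point N t i | i <- iota 0 N].

Let uniq_halton_points N t : uniq [seq halton_point N t i | i <- iota 0 N].
Proof.
case: N => // N; rewrite map_inj_uniq ?iota_uniq// => i j.
move=> /(congr1 (fun z : n.+1.-tuple R => tnth z ord0)); rewrite !tnth0.
have N0 : N.+1%:R^-1 != 0 :> R by rewrite invr_eq0 pnatr_eq0.
by move=> /(mulIf N0)/eqP; rewrite eqr_nat => /eqP.
Qed.

Let perm_halton_set N t :
  perm_eq (halton_set N t) [seq halton_point N t i | i <- iota 0 N].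
Proof.
by rewrite -[X in perm_eq _ X]undup_id ?uniq_halton_points// seq_fset_perm.
Qed.

Lemma card_halton_set N t : #|` halton_set N t|%fset = N.
Proof. by rewrite (perm_size (perm_halton_set N t)) size_map size_iota. Qed.

Lemma halton_set_unit_cube N t z : z \in halton_set N t -> unit_cube R n.+1 z.
Proof.
rewrite seq_fsetE => /mapP[i]; rewrite mem_iota add0n /= => iN -> {z} j.
rewrite in_itv /=; case: (unliftP ord0 j) => [k|] ->.
  by rewrite tnthS tnth_mktuple radical_inverse_itv// ltnW.
have N0 : (0 < N)%N by exact: leq_ltn_trans iN.
by rewrite tnth0 divr_ge0//= ltr_pdivrMr ?ltr0n// mul1r ltr_nat.
Qed.

Lemma discrepancy_halton_setE N t l x : (0 < N)%N -> (l <= N)%N ->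
  (forall i, (i < l)%N = (i%:R < N%:R * tnth x ord0)) ->
  discrepancy (halton_set N t) x =
    \sum_(i < l) \prod_(j < n)
      (radical_inverse R (b j) m (i + t) < nth 0 x j.+1)%R%:R -
    N%:R * tnth x ord0 * \prod_(j < n) nth 0 x j.+1.
Proof.
move=> N0 lN lE; rewrite /discrepancy card_halton_set.
rewrite big_ord_recl mulrA; congr (_ - _ * _); last first.
  by apply: eq_bigr => j _; rewrite (tnth_nth 0).
rewrite (perm_big _ (perm_halton_set N t)) big_map /=.
rewrite -[X in iota 0 X]subn0 -/(index_iota 0 N) big_mkord.
rewrite (big_ord_widen _ (fun i => \prod_(j < n)
  (radical_inverse R (b j) m (i + t) < nth 0 x j.+1)%R%:R) lN) [RHS]big_mkcond /=.
apply: eq_bigr => i _; rewrite indicE.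
have coord0 : (0 <= (i%:R / N%:R : R) < tnth x ord0) = (i < l)%N.
  by rewrite divr_ge0//= lE ltr_pdivrMr ?ltr0n// mulrC.
have [il|li] := ltnP i l; last first.
  rewrite memNset// => /(_ ord0); rewrite in_itv /= tnth0 coord0.
  by rewrite ltnNge li.
have [/forallP h|] := boolP [forall j : 'I_n,
    radical_inverse R (b j) m (i + t) < nth 0 x j.+1].
  rewrite mem_set ?big1// => [j _|j]; first by rewrite h.
  rewrite in_itv /=; case: (unliftP ord0 j) => [k|] ->.
    rewrite tnthS tnth_mktuple (tnth_nth 0) h.
    by have /andP[-> _] := radical_inverse_itv R (ltnW (b2 k)) m (i + t).
  by rewrite tnth0 coord0.
rewrite negb_forall => /existsP[j hj].
rewrite (bigD1 j)//= (negbTE hj) mul0r memNset// => /(_ (lift ord0 j)).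
by rewrite in_itv /= tnthS tnth_mktuple (tnth_nth 0) (negbTE hj) andbF.
Qed.

End halton_set.

Lemma exists_ceil (R : realType) N (x : R) : 0 <= x < 1 ->
  exists l, [/\ (l <= N)%N, N%:R * x <= l%:R <= N%:R * x + 1 &
    forall i, (i < l)%N = (i%:R < N%:R * x)].
Proof.
move=> /andP[x0 x1].
have ex : exists l, N%:R * x <= l%:R by exists N; rewrite ler_piMr// ltW.
have [l xl minl] := ex_minnP ex.
exists l; split.
- by apply: minl; rewrite ler_piMr// ltW.
- rewrite xl /=; case: l xl minl => [|l] xl minl; first by rewrite addr_ge0// mulr_ge0.
  rewrite -natr1 lerD2r ltW// ltNge; apply/negP => /minl.
  by rewrite ltnn.
- move=> i; apply/idP/idP => [il|xi].
    by rewrite ltNge; apply/negP => /minl; rewrite leqNgt il.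
  by rewrite -(ltr_nat R) (lt_le_trans xi).
Qed.

Section measurability.
Variables (R : realType) (d : nat).

Lemma measurable_unit_cube : measurable (unit_cube R d).
Proof.
rewrite (_ : unit_cube R d = \big[setI/setT]_(i <- index_enum 'I_d)
    ((@tnth d R)^~ i @^-1` `[0, 1[)).
  apply: bigsetI_measurable => i _.
  by rewrite -[X in measurable X]setTI; exact: measurable_tnth.
rewrite -bigcap_seq; apply/seteqP; split=> x /= H i => [_|]; first exact: H.
by apply: H => /=; rewrite mem_index_enum.
Qed.

Lemma lebesgue_unit_cube : lebesgue_tuple d (unit_cube R d) = 1%E.
Proof.
rewrite (_ : unit_cube R d = [set x | forall i, `[0, 1[%classic (tnth x i)])//.
rewrite (@lebesgue_tuple_box R d (fun=> `[0, 1[%classic))//.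
rewrite big1// => i _; rewrite lebesgue_measure_itv /= lte_fin ltr01.
by rewrite oppr0 adde0.
Qed.

Lemma measurable_discrepancy (P : {fset d.-tuple R}) :
  measurable_fun setT (discrepancy P).
Proof.
apply: measurable_funB; last first.
  apply: measurable_funM => //.
  by apply: measurable_prod => i _; exact: measurable_tnth.
apply: measurable_sum => z.
rewrite (_ : (fun x => _) = \1_[set x | anchored_box x z]); last first.
  by apply/funext => x; rewrite !indicE; congr (nat_of_bool _)%:R; apply/idP/idP;
    rewrite !inE.
apply: measurable_indic.
rewrite (_ : [set x | _] = \big[setI/setT]_(i <- index_enum 'I_d)
    ((@tnth d R)^~ i @^-1` [set u | tnth z i \in `[0, u[])).
  apply: bigsetI_measurable => i _.
  rewrite -[X in measurable X]setTI; apply: measurable_tnth => //.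
  have [z0|z0] := leP 0 (tnth z i).
    rewrite (_ : [set u | _] = `]tnth z i, +oo[%classic)//.
    by apply/seteqP; split => u /=; rewrite !in_itv /= z0 andbT.
  rewrite (_ : [set u | _] = set0)//.
  by apply/seteqP; split => u //=; rewrite in_itv /= leNgt z0.
rewrite -bigcap_seq; apply/seteqP; split=> x /= H i => [_|]; first exact: H.
by apply: H => /=; rewrite mem_index_enum.
Qed.

Lemma measurable_orlicz (psi : R -> R) (f : d.-tuple R -> R) (K : R) :
  orlicz_function psi -> 0 < K -> measurable_fun setT f ->
  measurable_fun setT (fun x => psi (`|f x| / K)).
Proof.
move=> psio K0 mf.
(* Extended by a constant to the negative numbers, psi is monotone. *)
rewrite (_ : (fun x => _) = (fun u => psi (Num.max 0 u)) \o (fun x => `|f x| / K)).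
  apply: measurableT_comp.
    apply: nondecreasing_measurable => // u v uv.
    apply: orlicz_homo => //; first by rewrite le_max lexx.
    by rewrite ge_max !le_max lexx uv orbT.
  apply: measurable_funM => //.
  exact: measurableT_comp.
apply/funext => x /=; rewrite max_r// divr_ge0// ltW//.
Qed.

End measurability.

(** If all the integrals were larger than 1, so would be their average, which is
    the integral of the average. *)
Lemma exists_integral_le1 (R : realType) d (F : nat -> d.-tuple R -> R) M :
  (0 < M)%N ->
  (forall t, measurable_fun setT (F t)) -> (forall t x, 0 <= F t x) ->
  (forall x, unit_cube R d x -> \sum_(t < M) F t x <= M%:R) ->
  exists t, (\int[lebesgue_tuple d]_(x in unit_cube R d) (F t x)%:E <= 1)%E.
Proof.
move=> M0 mF F0 FM; apply/not_existsP => h.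
have mC := @measurable_unit_cube R d.
have mFE t : measurable_fun (unit_cube R d) (fun x => (F t x)%:E).
  by apply/measurable_EFinP; exact: measurable_funTS.
pose I t := (\int[lebesgue_tuple d]_(x in unit_cube R d) (F t x)%:E)%E.
have sumI : (\sum_(t < M) I t <= M%:R%:E)%E.
  rewrite -(@ge0_integral_sum _ _ _ (lebesgue_tuple d) _ mC _
    (fun (t : 'I_M) x => (F t x)%:E))//; last by move=> t x _; rewrite lee_fin.
  apply: (@le_trans _ _ (\int[lebesgue_tuple d]_(x in unit_cube R d)
      (cst M%:R%:E x))%E); last first.
    by rewrite integral_cst// [X in (_ * X)%E]lebesgue_unit_cube mule1.
  apply: ge0_le_integral => //.
  - by move=> x _; apply: sume_ge0 => t _; rewrite lee_fin.
  - by apply: emeasurable_sum => t.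
  - by move=> x Cx; rewrite sumEFin lee_fin FM.
have I1 t : (1 < I t)%E by rewrite ltNge; apply/negP/h.
suff: (M%:R%:E < \sum_(t < M) I t)%E by rewrite ltNge sumI.
rewrite (_ : M%:R%:E = \sum_(t < M) 1%E)%E; last first.
  by rewrite sumEFin sumr_const card_ord.
case: M M0 {FM sumI} => // M _.
elim: M => [|M IH]; first by rewrite !big_ord1.
by rewrite big_ord_recr [X in (_ < X)%E]big_ord_recr /= lteD.
Qed.

(** * The exponential Orlicz norm of the discrepancy *)

Lemma up_log_le_ln (R : realType) N : (2 <= N)%N ->
  (up_log 2 N).+1%:R <= 3 / ln 2 * ln N%:R :> R.
Proof.
move=> N2; have /andP[mN _] := @up_log_bounds 2 N isT N2.
have l2 : 0 < ln 2 :> R by rewrite ln_gt0// ltr1n.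
have lN : ln 2 <= ln N%:R :> R.
  by rewrite ler_ln ?posrE ?ltr0n ?ler_nat// (leq_trans _ N2).
have m1 : (0 < up_log 2 N)%N by rewrite up_log_gt0.
have : ln (2 ^+ (up_log 2 N).-1) <= ln N%:R :> R.
  by rewrite ler_ln ?posrE ?exprn_gt0 ?ltr0n// ?(ltn_trans _ N2)// -natrX ler_nat ltnW.
rewrite lnXn// -[_ *+ _.-1]mulr_natl mulrAC ler_pdivlMr// => h.
rewrite -{1}(prednK m1) -natr1 -natr1; lra.
Qed.

(** Raising W = (|f| / K) ^ (2 / n) to the power n k gives back the moment of
    order 2k of f / K; the constant in K is the one that makes these moments at
    most (k / (2 e)) ^ (n k). *)
Lemma expR_powR_moment_le (R : realType) n M (f : nat -> R) (beta c L : R) :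
  (0 < n)%N -> 1 <= beta -> 0 < c -> c <= L ->
  (forall k, (0 < k)%N ->
    moment_le k M f ((c * (16 * k%:R)) ^+ n * beta ^+ 2)) ->
  \sum_(t < M) expR ((`|f t| /
    (32 * expR 1 * beta ^+ 2 * L) `^ (n%:R / 2)) `^ (2 / n%:R)) <= 3 * M%:R.
Proof.
move=> n0 b1 c0 cL fm; apply: (@expR_moment_le _ (fun t => (`|f t| /
    (32 * expR 1 * beta ^+ 2 * L) `^ (n%:R / 2)) `^ (2 / n%:R)) _ _ n0)
  => [t|k k0].
  exact: powR_ge0.
have nR : n%:R != 0 :> R by rewrite pnatr_eq0 -lt0n.
have e0 : 0 < expR 1 :> R by exact: expR_gt0.
have L0 : 0 < L := lt_le_trans c0 cL.
have b0 : 0 < beta := lt_le_trans ltr01 b1.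
set G := 32 * _ * _ * L; have G0 : 0 < G by rewrite !mulr_gt0.
have WE t : ((`|f t| / G `^ (n%:R / 2)) `^ (2 / n%:R)) ^+ (n * k) =
    f t ^+ k.*2 / G ^+ (n * k).
  have u0 : 0 <= `|f t| / G `^ (n%:R / 2) by rewrite divr_ge0 ?powR_ge0.
  rewrite exprM -[X in X ^+ k]powR_mulrn ?powR_ge0// -powRrM divfK//.
  rewrite powR_mulrn// -exprM mul2n expr_div_n; congr (_ / _).
    by rewrite -normrX ger0_norm// -mul2n exprM exprn_ge0// sqr_ge0.
  rewrite -mul2n exprM [RHS]exprM; congr (_ ^+ k).
  by rewrite -[LHS]powR_mulrn ?powR_ge0// -powRrM divfK// powR_mulrn// ltW.
under eq_bigr do rewrite WE.
rewrite -mulr_suml ler_pdivrMr ?exprn_gt0//.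
apply: le_trans (fm k k0) _; rewrite -mulrA ler_wpM2l//.
rewrite -exprMn (_ : _ * G = L * (16 * k%:R) * beta ^+ 2); last first.
  by rewrite /G; field; rewrite gt_eqF.
rewrite exprM; apply: lerXn2r.
- by rewrite nnegrE mulr_ge0 ?sqr_ge0 ?exprn_ge0// mulr_ge0// ltW.
- by rewrite nnegrE exprn_ge0// !mulr_ge0 ?(ltW L0) ?(ltW b0).
rewrite [leRHS]exprMn ler_pM ?sqr_ge0 ?exprn_ge0 ?mulr_ge0 ?(ltW c0)//.
  apply: lerXn2r; rewrite ?nnegrE ?mulr_ge0 ?(ltW c0) ?(ltW L0)//.
  by rewrite ler_wpM2r// mulr_ge0.
by rewrite ler_eXnr// exprn_ege1.
Qed.

Theorem theorem1p3 (R : realType) (d : nat) (hd : (3 <= d)%N)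
    (psi : R -> R) (hpsi : exp_orlicz_function (2 / (d%:R - 1)) psi) :
  exists2 C : R, 0 < C &
    forall N : nat, (2 <= N)%N ->
      exists P : {fset d.-tuple R},
        [/\ #|` P|%fset = N,
            (forall z, z \in P -> unit_cube R d z) &
            (orlicz_norm psi (discrepancy P) <=
               (C * ln N%:R `^ ((d%:R - 1) / 2))%:E)%E].
Proof.
case: d hd hpsi => // n hd; rewrite -(natr1 n) addrK => hpsi.
have n0 : (0 < n)%N by case: (n) hd.
have [A A0 psiA] := exp_orlicz_le hpsi.
have psio : orlicz_function psi by case: hpsi.
have b2 j : (1 < prime_seq j)%N by rewrite prime_gt1// prime_seqP.
pose beta : R := ((\prod_(j < n) prime_seq j) + n.+1)%:R.
have beta1 : 1 <= beta by rewrite ler1n addnS.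
have l2 : 0 < ln 2 :> R by rewrite ln_gt0// ltr1n.
have e0 : 0 < expR 1 :> R by exact: expR_gt0.
pose G := 32 * expR 1 * beta ^+ 2 * (3 / ln 2).
have b0 : 0 < beta := lt_le_trans ltr01 beta1.
have G0 : 0 < G by rewrite !mulr_gt0// invr_gt0.
exists ((A + 3) * G `^ (n%:R / 2)); first by rewrite mulr_gt0 ?powR_gt0//; lra.
move=> N N2; have N0 : (0 < N)%N by exact: ltnW.
pose m := up_log 2 N.
have lN : 0 < ln N%:R :> R by rewrite ln_gt0// ltr1n.
pose M := (\prod_(j < n) prime_seq j ^ m)%N.
have M0 : (0 < M)%N by rewrite prodn_gt0// => j; rewrite expn_gt0 (ltnW (b2 j)).
pose K0 := (G * ln N%:R) `^ (n%:R / 2).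
have K00 : 0 < K0 by rewrite powR_gt0// mulr_gt0.
pose K := (A + 3) * K0; have K1 : 0 < K by rewrite mulr_gt0//; lra.
pose P t := halton_set R n m prime_seq N t.
pose F t x := psi (`|discrepancy (P t) x| / K).
have [t Ft] : exists t, (\int[lebesgue_tuple n.+1]_(x in unit_cube R n.+1)
    (F t x)%:E <= 1)%E.
  apply: (exists_integral_le1 M0).
  - by move=> t; apply: measurable_orlicz => //; exact: measurable_discrepancy.
  - by move=> t x; apply: orlicz_ge0 => //; rewrite divr_ge0// ltW.
  move=> x Cx; have x01 j : 0 <= nth 0 x j < 1.
    have [jn|nj] := ltnP j n.+1; last by rewrite nth_default ?size_tuple// lexx ltr01.
    by have := Cx (Ordinal jn); rewrite in_itv (tnth_nth 0).
  have x0 : 0 <= tnth x ord0 < 1 by rewrite (tnth_nth 0); exact: x01.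
  have [l [lN' lE li]] := exists_ceil N x0.
  have Dm k : (0 < k)%N -> moment_le k M (fun t => discrepancy (P t) x)
      ((m.+1%:R * (16 * k%:R)) ^+ n * beta ^+ 2).
    move=> k0.
    rewrite (funext (fun t => discrepancy_halton_setE m b2 t N0 lN' li)).
    apply: (@halton_moment_le R n m prime_seq (fun j => nth 0 x j.+1) b2
      prime_seq_coprime (fun j => x01 j.+1) k N l _ k0) => //.
      by rewrite N0 up_logP.
    by case/andP: x0 => -> /ltW.
  have m0 : 0 < m.+1%:R :> R by rewrite ltr0n.
  have := expR_powR_moment_le n0 beta1 m0 (up_log_le_ln R N2) Dm.
  rewrite mulrA -/G -/K0 => expM.
  apply: (@le_trans _ _ (\sum_(t < M) (A + 3)^-1 *
      (A + expR ((`|discrepancy (P t) x| / K0) `^ (2 / n%:R))))).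
    apply: ler_sum => t _.
    have u0 : 0 <= `|discrepancy (P t) x| / K0 by rewrite divr_ge0// ltW.
    (* The factor A + 3 is taken out of K by convexity, and it compensates the
       bound on the average of A + exp. *)
    rewrite /F /K invfM mulrCA.
    apply: le_trans (orliczZ psio _ u0) _.
      by rewrite invr_ge0 invf_le1; lra.
    by rewrite ler_wpM2l ?psiA// invr_ge0; lra.
  rewrite -mulr_sumr ler_pdivrMl; last lra.
  rewrite big_split /= sumr_const card_ord -[X in X + _]mulr_natr; lra.
exists (P t); split.
- exact: card_halton_set.
- by move=> z; exact: halton_set_unit_cube.
rewrite -mulrA -powRM ?(ltW G0) ?(ltW lN)//.
apply: ereal_inf_lbound; exists K => //; split => //.
Qed.
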